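(* For every integer $n\geq 1$ with $n\not\equiv 2 \pmod 4$, $c_5(n)=c_6(n)$, where $c_5(n)=|\mathcal C_n^{++-}|$ and $c_6(n)=|\mathcal C_n^{+--}|$; thus the signatures $++-$ and $+--$ are weakly c-Wilf-equivalent.
   Context: $\mathcal S_n$ is the set of permutations of $[n]$ in one-line notation $\pi=\pi_1\cdots\pi_n$; $\mathcal C_n$ is the set of cyclic permutations (single $n$-cycle) in $\mathcal S_n$. For $\sigma=\sigma^0\cdots\sigma^{k-1}\in\{+,-\}^k$, $\mathcal S^\sigma_n$ is the set of $\pi\in\mathcal S_n$ for which there exist $0=e_0\le e_1\le\cdots\le e_k=n$ with each segment $\pi_{e_i+1}\cdots\pi_{e_{i+1}}$ increasing if $\sigma^i=+$ and decreasing if $\sigma^i=-$; $\mathcal C_n^\sigma=\mathcal C_n\cap\mathcal S_n^\sigma$. Two signatures are weakly c-Wilf-equivalent if for every $n\not\equiv 2\pmod 4$ they have equally many cyclic permutations of length $n$ in their classes. *)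

(* Defs.v *)
From mathcomp Require Import all_boot all_fingroup.
Set Implicit Arguments. Unset Strict Implicit. Unset Printing Implicit Defensive.

(* One-line notation of pi in S_n, with values shifted to {0,..,n-1}
   (monotonicity of segments is unaffected by the shift). *)
Definition oneline n (s : 'S_n) : seq nat := [seq val (s i) | i <- enum 'I_n].

Definition cyclicp n (s : 'S_n) : bool := #|porbits s| == 1%N.

(* Signatures: true = '+', false = '-'. *)
Definition signature := seq bool.

Definition in_class (n : nat) (sigma : signature) (w : seq nat) : bool :=
  [exists e : {ffun 'I_(size sigma).+1 -> 'I_n.+1},
    [&& val (e ord0) == 0, val (e ord_max) == n,
        [forall i : 'I_(size sigma).+1, forall j : 'I_(size sigma).+1,
           (i <= j) ==> (e i <= e j)] &
        [forall i : 'I_(size sigma),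
           let seg := drop (e (inord i)) (take (e (inord i.+1)) w) in
           if nth true sigma i then sorted ltn seg
           else sorted (fun a b => b < a) seg]]].

Definition Cclass (sigma : signature) (n : nat) : {set 'S_n} :=
  [set s : 'S_n | cyclicp s && in_class n sigma (oneline s)].

Definition cnt (sigma : signature) (n : nat) : nat := #|Cclass sigma n|.

Definition c5 n := cnt [:: true; true; false] n.
Definition c6 n := cnt [:: true; false; false] n.

(* Main.v *)
Require Import Defs.
From mathcomp Require Import all_boot all_fingroup.
From mathcomp Require Import zify.
Set Implicit Arguments. Unset Strict Implicit. Unset Printing Implicit Defensive.

(** Call (s, e1, e2) a segmented permutation when s is monotone with the
    prescribed signs on the three segments cut out by e1 <= e2. A permutation
    in the class of ++- that is not unimodal has exactly two segmentations;
    for a unimodal one the segmentations are in excess of 2 by the sum of its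
    two +- cut points, plus 1 unless it is increasing. Hence 2 c5(n) is the
    number of cyclic segmented permutations for ++-, minus the sum of e over
    the cyclic unimodal pairs (s, e), minus a correction; symmetrically for
    +-- with n - e instead of e. The two corrections agree because a cyclic
    permutation of length other than 2 is increasing iff it is decreasing.

    So it suffices that changing every sign and reversing the order of the
    segments preserves the number of cyclic segmented permutations with given
    segment lengths. Conjugation by the reversal of [n] reverses the segments
    without changing signs. To change all signs, write a cyclic s as the
    conjugate of the rotation by a permutation r, i.e. as a linear order on
    Z/n, and let W be the word of segment indices read along the cycle. The
    order of two points is governed by the first time t at which their
    itineraries in W differ, and flipping all signs reverses it exactly when t
    is odd. Two distinct points with equal itineraries must be n/2 apart, so
    for n not 2 mod 4 they have the same parity on Z/n, and that parity can
    be used in place of t. *)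

(** * Counting the cuts that fit a descent pattern *)

(* Cuts e1, e2 are allowed for the descent pattern D when every other adjacent
   pair is a descent exactly from position s on; the signature ++- is s = e2,
   the signature +-- is s = e1, and e1 = e2 = s gives +-. *)
Definition fits n (D : nat -> bool) (s e1 e2 : nat) : bool :=
  [forall i : 'I_n, [&& i.+1 < n, i.+1 != e1 & i.+1 != e2]
                     ==> (D i == (s <= i))].

Lemma fitsP n D s e1 e2 :
  reflect (forall i, i.+1 < n -> i.+1 <> e1 -> i.+1 <> e2 -> D i = (s <= i))
          (fits n D s e1 e2).
Proof.
apply: (iffP forallP) => [H i lti ne1 ne2 | H i].
  have /implyP/= := H (Ordinal (ltnW lti)).
  by rewrite lti /= => Hi; apply/eqP/Hi; apply/andP; split; apply/eqP.
by apply/implyP => /and3P[lti /eqP ne1 /eqP ne2]; apply/eqP/H.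
Qed.

Lemma first_true (D : nat -> bool) l u : l <= u ->
  exists a, [/\ l <= a, a <= u, forall i, l <= i -> i < a -> ~~ D i
              & a < u -> D a].
Proof.
elim: u => [|u IH] leu; first by exists 0; split=> //; lia.
case: (ltnP u l) => [ltul|leul]; first by exists l; split=> // *; lia.
have [a [la au Ha Hb]] := IH leul.
have [ltau|leua] := ltnP a u.
  by exists a; split=> //; [lia | move=> _; apply: Hb].
have eau : a = u by lia.
rewrite {}eau in Ha {Hb la au leua}.
case Du: (D u); first by exists u; split=> //; apply: leqnSn.
exists u.+1; split=> //; last by lia.
move=> i li iu; case: (ltnP i u) => [iltu|lei]; first by apply: Ha => //; lia.
have -> : i = u by lia.
by rewrite Du.
Qed.

Lemma last_false (D : nat -> bool) u :
  exists b, [/\ b <= u, forall i, b <= i -> i < u -> D i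
              & 0 < b -> ~~ D b.-1].
Proof.
elim: u => [|u [b [bu Hb Hb']]]; first by exists 0; split=> //; lia.
case Du: (D u).
  exists b; split=> //; first by lia.
  move=> i bi iu; case: (ltnP i u) => [iltu|lei]; first exact: Hb.
  by have -> : i = u by lia.
by exists u.+1; split=> // [|_]; [lia | rewrite Du].
Qed.

Lemma sum_nat_interval n l u : u < n ->
  \sum_(e < n) ((l <= e <= u) : nat) = u.+1 - l.
Proof.
move=> ltun; suff -> : \sum_(e < n) ((l <= e <= u) : nat) = minn n u.+1 - l.
  by congr (_ - _); lia.
elim: n {ltun} => [|n IH]; first by rewrite big_ord0; lia.
by rewrite big_ord_recr /= IH; lia.
Qed.

Lemma count_ppm m (D : nat -> bool) (n := m.+1) :
  \sum_(e1 < n.+1) \sum_(e2 < n.+1) ((e1 <= e2) && fits n D e2 e1 e2 : nat)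
  = 2 * [exists e1 : 'I_n.+1, exists e2 : 'I_n.+1,
           (e1 <= e2) && fits n D e2 e1 e2]
    + \sum_(e < n.+1) e * fits n D e e e
    + ([exists e : 'I_n.+1, fits n D e e e] && ~~ [forall i : 'I_m, ~~ D i]).
Proof.
(* [a] is the first descent ([m] if there is none), [b] the start of the final run of descents and,
   for [a < m], [a'] the next descent after [a], again with default [m]. *)
have [a [_ am Ha Da]] := first_true D (leq0n m).
have [b [bm Db Hb]] := last_false D m.
have [a' [ma' Ha' Da']] : exists a', [/\ (a < m -> a < a' <= m),
    (forall i, a < i -> i < a' -> ~~ D i) & (a < m -> a' < m -> D a')].
  case: (ltnP a m) => [ltam|leam]; last by exists 0; split=> // *; lia.
  by have [a' [? ? ? ?]] := first_true D ltam; exists a'; split=> // *; lia.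
(* The case [b = a] is the unimodal one; [b = a.+1] cannot occur, since the descent at [a] would
   extend the final run. *)
have ba : b = a \/ a.+1 < b.
  case: (ltngtP b a) => [lt||->]; [|move=> lt|by left].
    by have := Ha b (leq0n _) lt; rewrite (Db b) //; lia.
  right; rewrite ltn_neqAle lt andbT; apply/eqP => eb.
  by have := Hb; rewrite -eb /= => /(_ isT); rewrite Da //; lia.
(* A cut at [e] exempts the pair of index [e - 1]. Hence [e2] may reach [a.+1] for any [e1], and
   goes further only if [e1 = a.+1] hides the descent at [a]. *)
have fitE e1 e2 : e1 <= e2 -> e2 <= n ->
    fits n D e2 e1 e2 = (b <= e2 <= a.+1)
      || [&& e1 == a.+1, b <= e2, a.+1 < e2 & e2 <= a'.+1].
  move=> e12 e2n; apply/fitsP/idP => [F | FE i lti ne1 ne2].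
    have be2 : b <= e2.
      rewrite leqNgt; apply/negP => lt2.
      have b0 : 0 < b by lia.
      have := Hb b0.
      have [E|E] := eqVneq b e1; first by lia.
      by rewrite F ?prednK //; lia.
    rewrite be2 /=; case: (leqP e2 a.+1) => //= lt2.
    have lam : a < m by lia.
    have h : e1 = a.+1.
      case: (eqVneq e1 a.+1) => // ne.
      by have := Da lam; rewrite F; lia.
    rewrite h eqxx /= leqNgt; apply/negP => lt2'.
    by have := Da' lam; rewrite F; lia.
  case: (leqP e2 i) => e2i; first by apply: Db; lia.
  case/orP: FE => [/andP[be ea]|/and4P[/eqP E be ea ea']]; apply: negbTE.
    by apply: Ha; lia.
  case: (ltnP i a) => ia; first by apply: Ha.
  by apply: Ha'; lia.
have ordle (e : 'I_n.+1) : e <= n by rewrite -ltnS.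
have allE : [forall i : 'I_m, ~~ D i] = (a == m).
  apply/forallP/eqP => [F | E i]; last by apply: Ha; rewrite ?E.
  case: (ltnP a m) => [lt|]; last by lia.
  by have := F (Ordinal lt); rewrite /= (Da lt).
have diagE : \sum_(e < n.+1) e * fits n D e e e
     = \sum_(e < n.+1) e * (b <= e <= a.+1).
  by apply: eq_bigr => e _; rewrite fitE ?ordle //; congr (_ * nat_of_bool _); lia.
have exdE : [exists e : 'I_n.+1, fits n D e e e] = (b == a).
  apply/existsP/eqP => [[e]|E].
    by rewrite fitE ?ordle //; lia.
  have ln : a < n.+1 by lia.
  by exists (Ordinal ln); rewrite fitE /=; lia.
have exE : [exists e1 : 'I_n.+1, exists e2 : 'I_n.+1,
      (e1 <= e2) && fits n D e2 e1 e2] = (b == a) || (b <= a'.+1) && (a < m).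
  apply/existsP/idP => [[e1 /existsP[e2 /andP[e12]]]|].
    rewrite fitE ?ordle //; have := ltn_ord e2; rewrite /n; lia.
  case/orP => [/eqP E|/andP[ba' lam]].
    have ln : a < n.+1 by lia.
    exists (Ordinal ln); apply/existsP; exists (Ordinal ln).
    by rewrite leqnn /= fitE /=; lia.
  case: ba => [E|ba].
    have ln : a < n.+1 by lia.
    exists (Ordinal ln); apply/existsP; exists (Ordinal ln).
    by rewrite leqnn /= fitE /=; lia.
  have l1 : a.+1 < n.+1 by lia.
  have l2 : b < n.+1 by lia.
  exists (Ordinal l1); apply/existsP; exists (Ordinal l2) => /=.
  by rewrite fitE /=; lia.
rewrite diagE exE exdE allE.
rewrite exchange_big /=.
have splitE (e1 e2 : 'I_n.+1) :
   ((e1 <= e2) && fits n D e2 e1 e2 : nat) =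
   ((b <= e2 <= a.+1) * (0 <= e1 <= e2)) +
   ((a.+1 <= e1 <= a.+1) * [&& b <= e2, a.+1 < e2 & e2 <= a'.+1]).
  case: (leqP e1 e2) => e12; last by clear -e12; lia.
  by rewrite fitE ?ordle //=; clear -e12; lia.
have innerE (e2 : 'I_n.+1) :
   \sum_(e1 < n.+1) ((e1 <= e2) && fits n D e2 e1 e2 : nat) =
   e2 * (b <= e2 <= a.+1) + (b <= e2 <= a.+1)
   + [&& b <= e2, a.+1 < e2 & e2 <= a'.+1].
  under eq_bigr => e1 _ do rewrite splitE.
  rewrite big_split -big_distrr -big_distrl.
  rewrite sum_nat_interval // (@sum_nat_interval n.+1 a.+1 a.+1) //.
  by rewrite subSnn /=; clear; lia.
under eq_bigr => e2 _ do rewrite innerE.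
rewrite !big_split /= sum_nat_interval //.
case: (ltnP a m) => [lam|leam]; last first.
  rewrite [X in _ + X]big1 => [|e _]; first by lia.
  by have := ltn_ord e; rewrite /n; lia.
have -> : \sum_(e < n.+1) [&& b <= e, a.+1 < e & e <= a'.+1] =
   \sum_(e < n.+1) ((maxn b a.+2 <= e <= a'.+1) : nat).
  by apply: eq_bigr => e _; lia.
rewrite sum_nat_interval; last by lia.
(* With [e1 = a.+1] the further values of [e2] are just [a.+2] in the unimodal case; otherwise they
   are [a'] and [a'.+1], or there are none. *)
have aa' : b = a -> a' = a.+1.
  move=> E; case: (ltngtP a' a.+1) => // h; first by lia.
  by have := Ha' a.+1 (ltnSn _) h; rewrite Db //; lia.
have ba2 : a.+1 < b -> b <= a'.+1 -> b = a'.
  move=> h1 h2; case: (ltngtP b a') => // h.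
    by have := Ha' b (ltnW h1) h; rewrite Db //; lia.
  have e: b = a'.+1 by lia.
  by have := Hb; rewrite e /= Da' //; lia.
lia.
Qed.

(** Reading a word backwards replaces its descent pattern [D] by [D'], the signature +-- by ++- and
    a cut [e] by [n - e], which reduces the count to [count_ppm]. *)
Lemma count_pmm m (D : nat -> bool) (n := m.+1) :
  \sum_(e1 < n.+1) \sum_(e2 < n.+1) ((e1 <= e2) && fits n D e1 e1 e2 : nat)
  = 2 * [exists e1 : 'I_n.+1, exists e2 : 'I_n.+1,
           (e1 <= e2) && fits n D e1 e1 e2]
    + \sum_(e < n.+1) (n - e) * fits n D e e e
    + ([exists e : 'I_n.+1, fits n D e e e] && ~~ [forall i : 'I_m, D i]).
Proof.
pose D' i := ~~ D (m.-1 - i).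
have ordle (e : 'I_n.+1) : e <= n by rewrite -ltnS.
have fitD e1 e2 : e1 <= n -> e2 <= n ->
    fits n D e1 e1 e2 = fits n D' (n - e1) (n - e2) (n - e1).
  move=> e1n e2n; apply/fitsP/fitsP => F i lti ne1 ne2.
    by rewrite /D' F; lia.
  have := F (m.-1 - i); rewrite /D'.
  have -> : m.-1 - (m.-1 - i) = i by lia.
  case: (D i) => /(_ _ _ _)/= F'; [have := F' _ _ _|have := F' _ _ _]; lia.
have fitD1 (e1 e2 : 'I_n.+1) : (e1 <= e2) && fits n D e1 e1 e2 =
    (rev_ord e2 <= rev_ord e1) && fits n D' (rev_ord e1) (rev_ord e2) (rev_ord e1).
  rewrite /= !subSS -fitD ?ordle //; congr (_ && _).
  by have := ordle e1; have := ordle e2; lia.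
have fitD2 (e : 'I_n.+1) :
    fits n D e e e = fits n D' (rev_ord e) (rev_ord e) (rev_ord e).
  by rewrite /= !subSS -fitD ?ordle.
have revi : injective (@rev_ord n.+1) := rev_ord_inj.
transitivity (\sum_(e1 < n.+1) \sum_(e2 < n.+1)
    ((e1 <= e2) && fits n D' e2 e1 e2 : nat)).
  rewrite exchange_big /= (reindex_inj revi); apply: eq_bigr => e2 _.
  rewrite (reindex_inj revi); apply: eq_bigr => e1 _.
  by rewrite fitD1 !rev_ordK.
rewrite count_ppm; congr (2 * nat_of_bool _ + _ + nat_of_bool (_ && ~~ _)).
- apply/existsP/existsP => [] [e1 /existsP[e2 H]];
    exists (rev_ord e2); apply/existsP; exists (rev_ord e1).
    by rewrite fitD1 !rev_ordK.
  by rewrite -fitD1.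
- rewrite (reindex_inj revi); apply: eq_bigr => e _.
  by rewrite fitD2 /= subSS.
- apply/existsP/existsP => [] [e He]; exists (rev_ord e).
    by rewrite fitD2 !rev_ordK.
  by rewrite -fitD2.
apply/forallP/forallP => H i; last by rewrite /D' negbK; have := H (rev_ord i);
  congr (is_true (D _)); rewrite /=; lia.
by have := H (rev_ord i); rewrite /D' negbK; congr (is_true (D _));
  have := ltn_ord i; rewrite /=; lia.
Qed.

(** * Itineraries and the parity of their first difference *)

(* Parity of the first time at which the itineraries from t and u differ; the
   fuel value odd t is consistent with the recursion if they never do. *)
Fixpoint flip_parity (W : nat -> nat) k t u : bool :=
  if k is k'.+1 then (W t == W u) && ~~ flip_parity W k' t.+1 u.+1 else odd t.

Lemma flip_parityS W k t u : W (t + k) = W (u + k) ->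
  flip_parity W k.+1 t u = flip_parity W k t u.
Proof.
elim: k t u => [|k IH] t u; first by rewrite !addn0 /= negbK => ->; rewrite eqxx.
by rewrite !addnS -!addSn => /IH E; rewrite [LHS]/= [X in ~~ X]E.
Qed.

Lemma flip_parity_ext W W' k t u :
  W =1 W' -> flip_parity W k t u = flip_parity W' k t u.
Proof. by move=> eqW; elim: k t u => //= k IH t u; rewrite !eqW IH. Qed.

(** The starting time enters only through the default value, so its parity matters only when all [k]
    letters agree. *)
Lemma eq_flip_parity W k t u t' u' :
  (forall i, (W (t + i) == W (u + i)) = (W (t' + i) == W (u' + i))) ->
  ((forall i, i < k -> W (t + i) = W (u + i)) -> odd t = odd t') ->
  flip_parity W k t u = flip_parity W k t' u'.
Proof.
elim: k t u t' u' => [|k IH] t u t' u' eqW eqo /=; first exact: eqo.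
have := eqW 0; rewrite !addn0 => <-; case: eqP => //= Wtu; congr (~~ _).
apply: IH => [i|same]; first by rewrite !addSnnS eqW.
rewrite /= eqo // => -[|i] ltik; rewrite ?addn0 // -!addSnnS; exact: same.
Qed.

Section Aligned.

(** Time runs along the cycle: [R t] is the position at time [t], [W t] its segment index, and [neg]
    marks the decreasing segments. *)
Variables (n : nat) (R W : nat -> nat) (neg : nat -> bool).
Hypothesis n_gt0 : 0 < n.
Hypothesis R_per : forall t, R (t + n) = R t.
Hypothesis R_inj : forall t u, R t = R u -> t = u %[mod n].
Hypothesis W_per : forall t, W (t + n) = W t.
Hypothesis R_step : forall t u, W t = W u -> t <> u %[mod n] ->
  (R t.+1 < R u.+1) = (R t < R u) (+) neg (W t).

Lemma per_mul (V : nat -> nat) : (forall t, V (t + n) = V t) ->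
  forall k t, V (t + k * n) = V t.
Proof.
by move=> V_per; elim=> [|k IH] t; rewrite ?mul0n ?addn0 // mulSn addnA IH.
Qed.

Let par t k := odd (\sum_(i < k) neg (W (t + i))).

Lemma R_iter k t u : (forall i, W (t + i) = W (u + i)) -> t <> u %[mod n] ->
  (R (t + k) < R (u + k)) = (R t < R u) (+) par t k.
Proof.
move=> sameW netu; elim: k => [|k IH].
  by rewrite !addn0 /par big_ord0 addbF.
rewrite !addnS R_step //.
  by rewrite IH -addbA /par big_ord_recr /= oddD oddb.
by move=> /eqP; rewrite eqn_modDr => /eqP.
Qed.

Lemma par_double d t : (forall i, W (i + d) = W i) -> par t (d + d) = false.
Proof.
move=> W_d; rewrite /par big_split_ord /= oddD; apply/eqP; rewrite addbC.
rewrite (_ : \sum_(i < d) neg (W (t + (d + i))) = \sum_(i < d) neg (W (t + i))).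
  by rewrite addbb.
by apply: eq_bigr => i _; rewrite addnCA addnC W_d.
Qed.

(* A shift by a period d of W is monotone on the points of one itinerary, so
   the shift by 2d is increasing there, hence trivial. *)
Lemma same_itinerary t d : 0 < d -> d < n ->
  (forall i, W (t + i) = W (t + d + i)) -> n = d.*2.
Proof.
move=> d_gt0 ltdn sameW.
(* Adding multiples of [n] moves any time past [t], so agreement from [t] on gives the period [d]
   everywhere. *)
have W_d x : W (x + d) = W x.
  rewrite -(per_mul W_per t) -(per_mul W_per t x).
  have ltx : t <= x + t * n by rewrite (leq_trans (leq_pmulr t n_gt0)) ?leq_addl.
  have -> : x + d + t * n = t + d + (x + t * n - t) by lia.
  by rewrite -sameW; congr W; lia.
suff : d.*2 = 0 %[mod n].
  rewrite mod0n => /eqP/dvdnP[[|[|k]]]; lia.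
case: (eqVneq (d.*2 %% n) 0) => [->|ne0]; first by rewrite mod0n.
(* All consecutive comparisons along the shift by [d.*2] agree, so [g] is strictly monotone, against
   [g n = g 0]. *)
pose g k := R (t + k * d.*2).
have nek k : t + k * d.*2 <> t + k.+1 * d.*2 %[mod n].
  move/eqP; rewrite mulSn addnCA -{1}[t + _]add0n eqn_modDr mod0n eq_sym.
  exact/negP.
have gS k : (g k.+1 < g k.+2) = (g k < g k.+1).
  rewrite /g -[in LHS]addnn.
  have -> : t + k.+1 * (d + d) = t + k * d.*2 + (d + d) by lia.
  have -> : t + k.+2 * (d + d) = t + k.+1 * d.*2 + (d + d) by lia.
  rewrite R_iter ?par_double ?addbF // => i.
  have -> : t + k.+1 * d.*2 + i = t + k * d.*2 + i + d + d by lia.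
  by rewrite !W_d.
have gE k : (g k < g k.+1) = (g 0 < g 1) by elim: k => // k <-.
have gne k : g k <> g k.+1 by move/R_inj/nek.
have gn : g n = g 0 by rewrite /g mul0n addn0 mulnC per_mul.
have [lt01|le10] := boolP (g 0 < g 1).
  have lt0 k : g 0 < g k.+1.
    by elim: k => // k IH; apply: (ltn_trans IH); rewrite gE.
  by have := lt0 n.-1; rewrite prednK // gn ltnn.
have lt0 k : g k.+1 < g 0.
  have gS' j : g j.+1 < g j.
    by have := gE j; rewrite (negbTE le10); have := gne j; lia.
  by elim: k => // k IH; apply: ltn_trans IH.
by have := lt0 n.-1; rewrite prednK // gn ltnn.
Qed.

End Aligned.

(** * Permutations from linear orders, and monotonicity on level sets *)

Lemma rank_perm n (r : rel 'I_n) : irreflexive r -> transitive r ->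
  (forall j l, j != l -> r l j = ~~ r j l) ->
  exists t : 'S_n, forall j l, (t j < t l) = r j l.
Proof.
move=> r_irr r_tr r_tot.
pose rk j := #|[set i | r i j]|.
have rk_lt j l : r j l -> rk j < rk l.
  move=> rjl; apply: proper_card; apply/properP; split.
    by apply/subsetP => i; rewrite !inE => rij; apply: r_tr rjl.
  by exists j; rewrite !inE ?r_irr.
have rkn j : rk j < n.
  rewrite -[X in _ < X]card_ord -cardsT; apply: proper_card.
  by apply/properP; split; [apply: subsetT | exists j; rewrite !inE ?r_irr].
pose t0 j := Ordinal (rkn j).
have ltE j l : (t0 j < t0 l) = r j l.
  have [->|ne] := eqVneq j l; first by rewrite ltnn r_irr.
  case rjl: (r j l); first exact: rk_lt.
  have : r l j by rewrite r_tot // rjl.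
  by move/rk_lt => lt /=; apply/negbTE; rewrite -leqNgt ltnW.
have t0_inj : injective t0.
  move=> j l E; apply/eqP; case: (eqVneq j l) => // ne.
  have := r_tot _ _ ne; rewrite -!ltE E ltnn.
  by [].
by exists (perm t0_inj) => j l; rewrite !permE ltE.
Qed.

Definition compat n (f : 'I_n -> nat) (neg : nat -> bool) (s : 'S_n) : bool :=
  [forall i : 'I_n, forall j : 'I_n,
    (i < j) && (f i == f j) ==> ((s i < s j) == ~~ neg (f i))].

Lemma compatP n (f : 'I_n -> nat) neg (s : 'S_n) :
  reflect (forall i j, i != j -> f i = f j ->
             (s i < s j) = (i < j) (+) neg (f i))
          (compat f neg s).
Proof.
apply: (iffP forallP) => [H | H i].
  have H' (i j : 'I_n) : i < j -> f i = f j -> (s i < s j) = ~~ neg (f i).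
    move=> lij eij; have /forallP/(_ j)/implyP := H i.
    by rewrite lij eij eqxx => /(_ isT)/eqP.
  move=> i j; case: (ltngtP i j) => [lij|lji|/val_inj ->]; last by rewrite eqxx.
    by move=> _ eij; rewrite H'.
  move=> nij eij; have := H' _ _ lji (esym eij); rewrite -eij => E.
  have := nij; rewrite -(inj_eq (@perm_inj _ s)) -val_eqE /=.
  by move: E; case: (ltngtP (s i) (s j)); case: (neg _).
apply/forallP => j; apply/implyP => /andP[lij /eqP eij]; apply/eqP.
have ne : i != j by rewrite -val_eqE neq_ltn lij.
by rewrite H // lij.
Qed.

(** * Conjugates of the rotation and the sign flip *)

Section Rotation.

Variable m : nat.
Let n := m.+1.

Definition rotp : 'S_n := perm (@ordS_inj n).

Definition pt (t : nat) : 'I_n := inord (t %% n).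

Lemma val_pt t : pt t = t %% n :> nat.
Proof. by rewrite inordK // ltn_mod. Qed.

Lemma pt_val (j : 'I_n) : pt j = j.
Proof. by apply: val_inj; rewrite /= val_pt modn_small. Qed.

Lemma rotp_pt t : rotp (pt t) = pt t.+1.
Proof. by apply: val_inj; rewrite permE /= !val_pt -addn1 modnDml addn1. Qed.

Lemma ptD t : pt (t + n) = pt t.
Proof. by apply: val_inj; rewrite /= !val_pt modnDr. Qed.

Lemma eq_pt t u : (pt t == pt u) = (t == u %[mod n]).
Proof. by rewrite -val_eqE /= !val_pt. Qed.

(** The value at [j] is the number of points placed below [j], so the comparisons determine the
    permutation. *)
Lemma eq_perm_lt (r1 r2 : 'S_n) :
  (forall j l, j != l -> (r1 j < r1 l) = (r2 j < r2 l)) -> r1 = r2.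
Proof.
move=> H; have rk (r : 'S_n) j : r j = #|[set l | r l < r j]| :> nat.
  have -> : [set l | r l < r j] = r @^-1: [set i : 'I_n | i < r j].
    by apply/setP => l; rewrite !inE.
  rewrite card_preimset; last exact: perm_inj.
  rewrite cardsE -sum1_card big_mkcond /=.
  rewrite -(big_mkord xpredT (fun i => if i \in [pred x : nat | x < r j] then 1 else 0)).
  rewrite -big_mkcond /= (big_cat_nat (n := r j)) //=; last exact: ltnW.
  rewrite big_nat_cond (eq_bigl (fun i => 0 <= i < r j)); last first.
    by move=> i; rewrite inE; lia.
  rewrite -big_nat sum_nat_const_nat subn0 muln1.
  rewrite big_nat_cond big_pred0 ?addn0 // => i; rewrite inE; lia.
apply/permP => j; apply: val_inj; rewrite /= [LHS]rk [RHS]rk; apply: eq_card => l.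
rewrite !inE; have [->|ne] := eqVneq l j; first by rewrite !ltnn.
exact: H.
Qed.

Variable f : 'I_n -> nat.
Hypothesis f_homo : forall i j : 'I_n, i <= j -> f i <= f j.

(** Here [r j] is the position at time [j]: the conjugate [rotp ^ r] maps it to [r (rotp j)]. *)
Definition aligned (neg : nat -> bool) (r : 'S_n) := compat f neg (rotp ^ r)%g.

Lemma alignedP neg (r : 'S_n) :
  reflect (forall j l, j != l -> f (r j) = f (r l) ->
             (r (rotp j) < r (rotp l)) = (r j < r l) (+) neg (f (r j)))
          (aligned neg r).
Proof.
apply: (iffP (compatP _ _ _)) => H j l ne eqf.
  by rewrite -(permJ rotp r j) -(permJ rotp r l) H // (inj_eq perm_inj).
rewrite -{1}[j](permKV r) -{1}[l](permKV r) !permJ H ?permKV //.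
by rewrite (inj_eq perm_inj).
Qed.

Hypothesis n_mod4 : n %% 4 != 2.

Definition flipped (r r' : 'S_n) : Prop :=
  (forall j, f (r' j) = f (r j)) /\
  forall j l : 'I_n, j != l ->
    (r' j < r' l) = (r j < r l) (+) flip_parity (fun t => f (r (pt t))) n j l.

(** Either permutation lists the values of [w] in nondecreasing order, and the sorted list is
    unique. *)
Lemma sorted_perm_eq (w : 'I_n -> nat) (r r' : 'S_n) :
  (forall j l, w j < w l -> r j < r l) -> (forall j l, w j < w l -> r' j < r' l) ->
  forall i, w (r^-1%g i) = w (r'^-1%g i).
Proof.
move=> Hr Hr'.
pose g (r : 'S_n) := mkseq (fun i => w (r^-1%g (inord i))) n.
have gs (q : 'S_n) : (forall j l, w j < w l -> q j < q l) -> sorted leq (g q).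
  move=> Hq; apply/(sortedP 0) => i; rewrite size_mkseq => lti.
  rewrite !nth_mkseq ?(ltnW lti) //.
  rewrite leqNgt; apply/negP => /Hq; rewrite !permKV.
  by rewrite !inordK ?(ltnW lti) // ltnNge leqnSn.
have gp (q : 'S_n) : perm_eq (g q) [seq w i | i <- enum 'I_n].
  have -> : g q = [seq w (q^-1%g i) | i <- enum 'I_n].
    rewrite /g /mkseq -val_enum_ord -map_comp; apply: eq_map => i /=.
    by rewrite inord_val.
  rewrite (map_comp w (fun i => q^-1%g i)); apply: perm_map.
  apply: uniq_perm; last 1 first.
  - move=> i; rewrite mem_enum; apply/mapP; exists (q i); rewrite ?mem_enum //.
    by rewrite permK.
  - by rewrite (map_inj_uniq perm_inj) enum_uniq.
  - exact: enum_uniq.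
have E : g r = g r'.
  apply: (sorted_eq leq_trans anti_leq (gs _ Hr) (gs _ Hr')).
  by rewrite (permPl (gp r)) perm_sym.
move=> i; have := congr1 (nth 0 ^~ i) E.
by rewrite /= !nth_mkseq // !inord_val.
Qed.

(** The order of [r], reversed where the parity is odd, is a strict total order, and its ranks form
    [r']. A rotation step with equal letters toggles the parity, which negates the sign. *)
Lemma flip_exists neg (r : 'S_n) : aligned neg r ->
  exists2 r', aligned (fun a => ~~ neg a) r' & flipped r r'.
Proof.
move/alignedP => Hr; pose W t := f (r (pt t)); pose R t : nat := r (pt t).
have R_per t : R (t + n) = R t by rewrite /R ptD.
have W_per t : W (t + n) = W t by rewrite /W ptD.
have R_inj t u : R t = R u -> t = u %[mod n].
  by move/val_inj/perm_inj/eqP; rewrite eq_pt => /eqP.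
have R_step t u : W t = W u -> t <> u %[mod n] ->
    (R t.+1 < R u.+1) = (R t < R u) (+) neg (W t).
  by move=> eqW /eqP ne; rewrite /R -!rotp_pt Hr // eq_pt.
have twin (j l : 'I_n) : j < l -> (forall i, W (j + i) = W (l + i)) ->
    n = (l - j).*2.
  move=> ltjl same.
  apply: (same_itinerary (t := j) (ltn0Sn m) R_per R_inj W_per R_step).
  - by rewrite subn_gt0.
  - by rewrite (leq_ltn_trans (leq_subr _ _)).
  by move=> i; rewrite subnKC ?same // ltnW.
have W_mod t : W (t %% n) = W t.
  by rewrite /W; congr (f (r _)); apply/eqP; rewrite eq_pt modn_mod.
have sameW t u : (forall i, i < n -> W (t + i) = W (u + i)) ->
    forall i, W (t + i) = W (u + i).
  move=> H i; rewrite -W_mod -modnDmr W_mod -[RHS]W_mod -[in RHS]modnDmr W_mod.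
  by apply: H; rewrite ltn_mod.
have twin2 (j l : 'I_n) : j != l -> (forall i, i < n -> W (j + i) = W (l + i)) ->
    n = (l - j + (j - l)).*2.
  move=> ne /sameW H; have : (j < l) || (l < j) by rewrite -neq_ltn val_eqE.
  case/orP => lt; [have := twin _ _ lt H | have := twin _ _ lt (fun i => esym (H i))]; lia.
pose dif := flip_parity W n.
(* If the itineraries never differ, [n] is twice the distance, so 4 divides [n] and [j], [l] have
   equal parity. *)
have difC (j l : 'I_n) : j != l -> dif j l = dif l j.
  move=> ne; apply: eq_flip_parity => [i|H]; first exact: eq_sym.
  have := twin2 _ _ ne H; have := n_mod4; lia.
have dif_rot (j l : 'I_n) : j != l -> W j = W l ->
    dif (rotp j) (rotp l) = ~~ dif j l.
  move=> ne eqW.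
  (* Reducing [j.+1] mod [n] could alter the default parity, but the default is reached only when
     [n] is even. *)
  have -> : dif (rotp j) (rotp l) = dif j.+1 l.+1.
    rewrite -{1}[j]pt_val -{1}[l]pt_val !rotp_pt !val_pt; apply: eq_flip_parity.
      by move=> i; rewrite -W_mod modnDml W_mod -[W (_ %% n + i)]W_mod modnDml W_mod.
    move=> H; have Hn : n = (l - j + (j - l)).*2.
      apply: twin2 => // -[|i] lti; first by rewrite !addn0.
      rewrite -!addSnnS; have := H i (ltnW lti).
      by rewrite -W_mod modnDml W_mod -[W (_ %% n + i)]W_mod modnDml W_mod.
    have n_even : odd n = false by rewrite Hn odd_double.
    by rewrite [in RHS](divn_eq j.+1 n) oddD oddM n_even andbF.
  have E : flip_parity W n.+1 j l = ~~ dif j.+1 l.+1.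
    by rewrite [LHS]/= eqW eqxx.
  by rewrite -[dif j l]flip_parityS ?W_per // E negbK.
pose lt' (j l : 'I_n) := (j != l) && ((r j < r l) (+) dif j l).
have lt'C j l : j != l -> lt' l j = ~~ lt' j l.
  move=> ne; rewrite /lt' eq_sym ne /= -difC //.
  have : (r j != r l :> nat) by rewrite val_eqE (inj_eq perm_inj).
  by case: (ltngtP (r j) (r l)) => //=; case: (dif _ _).
(* Distinct letters differ at time 0, which is even: the order is unchanged, and [f_homo] decides
   it. *)
have lt'W (j l : 'I_n) : W j < W l -> lt' j l.
  move=> ltW; have ne : j != l by apply: contraTneq ltW => ->; rewrite ltnn.
  rewrite /lt' ne /dif /= (ltn_eqF ltW) /= addbF ltnNge.
  apply: contraL ltW; rewrite -leqNgt /W !pt_val; exact: f_homo.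
have lt'S (j l : 'I_n) : j != l -> W j = W l ->
    lt' (rotp j) (rotp l) = lt' j l (+) ~~ neg (W j).
  move=> ne eqW; rewrite /lt' (inj_eq perm_inj) ne /= dif_rot //.
  have := eqW; rewrite /W !pt_val => eqW'.
  by rewrite Hr //; case: (_ < _); case: (neg _); case: (dif _ _).
(* No 3-cycle: as long as the three points carry the same letter, rotating
   them keeps or reverses the cycle, and three points cannot share an
   itinerary. *)
pose cyc j l k := [&& lt' j l, lt' l k & lt' k j].
have ne3 j l k : cyc j l k || cyc k l j -> [/\ j != l, l != k & k != j].
  by rewrite /cyc /lt' ![l == j]eq_sym ![k == l]eq_sym ![j == k]eq_sym;
     case/orP => /and3P[/andP[? _] /andP[? _] /andP[? _]].
have eqW3 (j l k : 'I_n) : cyc j l k -> W j = W l /\ W l = W k.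
  case/and3P => jl lk kj.
  have ltF (x y : 'I_n) : lt' x y -> W x <= W y.
    move=> xy; rewrite leqNgt; apply/negP => /lt'W yx.
    have ne : x != y by case/andP: xy.
    by move: yx; rewrite lt'C // xy.
  by have := ltF _ _ jl; have := ltF _ _ lk; have := ltF _ _ kj; lia.
have cycS (j l k : 'I_n) : cyc j l k || cyc k l j ->
   [/\ W j = W l, W l = W k &
     cyc (rotp j) (rotp l) (rotp k) || cyc (rotp k) (rotp l) (rotp j)].
  move=> H; have [n1 n2 n3] := ne3 _ _ _ H.
  have [e1 e2] : W j = W l /\ W l = W k.
    by case/orP: H => /eqW3[]; [split | move=> -> ->].
  split=> //; have e3 : W k = W j by rewrite e1 e2.
  have [n1' n2' n3'] : [/\ l != j, k != l & j != k].
    by rewrite ![_ == j]eq_sym [k == l]eq_sym n1 n2 eq_sym n3.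
  rewrite /cyc !lt'S // -?e1 -?e2 // -?e1.
  move: H; rewrite /cyc; rewrite (lt'C _ _ n1) (lt'C _ _ n2) (lt'C _ _ n3).
  by case: (lt' j l); case: (lt' l k); case: (lt' k j); case: (neg _).
have nocycle j l k : lt' j l -> lt' l k -> lt' k j -> False.
  move=> jl lk kj.
  have H0 : cyc j l k || cyc k l j by rewrite /cyc jl lk kj.
  have Hi i : [/\ W (j + i) = W (l + i), W (l + i) = W (k + i) &
      cyc (pt (j + i)) (pt (l + i)) (pt (k + i)) ||
      cyc (pt (k + i)) (pt (l + i)) (pt (j + i))].
    have key x y z : cyc (pt x) (pt y) (pt z) || cyc (pt z) (pt y) (pt x) ->
        [/\ W x = W y, W y = W z & cyc (pt x) (pt y) (pt z) || cyc (pt z) (pt y) (pt x)].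
      move=> H; have [] := cycS _ _ _ H; rewrite !val_pt !W_mod => -> -> _.
      by split.
    elim: i => [|i [_ _ IH]]; first by apply: key; rewrite !addn0 !pt_val.
    by apply: key; rewrite !addnS -!rotp_pt; have [] := cycS _ _ _ IH.
  (* Three distinct points of ['I_n] cannot be pairwise [n / 2] apart. *)
  have [n1 n2 n3] := ne3 _ _ _ H0.
  have := twin2 _ _ n1 (fun i _ => let: And3 a _ _ := Hi i in a).
  have := twin2 _ _ n2 (fun i _ => let: And3 _ a _ := Hi i in a).
  have := twin2 _ _ n3 (fun i _ => let: And3 a b _ := Hi i in esym (etrans a b)).
  by move: n1 n2 n3; rewrite -!val_eqE /=; lia.
have lt'_irr : irreflexive lt' by move=> j; rewrite /lt' eqxx.
have lt'_tr : transitive lt'.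
  move=> l j k jl lk; have [E|ne] := eqVneq j k.
    have nl : j != l by case/andP: jl.
    by move: lk; rewrite -E lt'C // jl.
  by rewrite -[lt' j k]negbK -lt'C //; apply/negP => kj; apply: (nocycle j l k).
have [r' r'E] := rank_perm lt'_irr lt'_tr lt'C.
have Wf j : W (val j) = f (r j) by rewrite /W pt_val.
(* Both [r] and [r'] arrange the times by nondecreasing letter, so every position receives the same
   letter from either. *)
have fr' j : f (r' j) = f (r j).
  have := @sorted_perm_eq (fun j => W j) r r' _ _ (r' j).
  rewrite permK !Wf permKV => -> // i l; last by move/lt'W; rewrite -r'E.
  by rewrite !Wf => ltf; rewrite ltnNge; apply: contraL ltf; rewrite -leqNgt; apply: f_homo.
exists r'; last first.
  by split=> // j l ne; rewrite r'E /lt' ne.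
apply/alignedP => j l ne; rewrite !fr' => eqf.
by rewrite !r'E lt'S ?Wf.
Qed.

(** * From conjugators to cyclic permutations *)

Lemma cyclicpP (s : 'S_n) x : reflect (forall y, y \in porbit s x) (cyclicp s).
Proof.
apply: (iffP cards1P) => [[A EA] y | H].
  have inA z : porbit s z = A by apply/set1P; rewrite -EA imset_f.
  by rewrite -[_ \in _]porbit_sym -eq_porbit_mem !inA.
exists (porbit s x); apply/setP => A; rewrite inE; apply/imsetP/eqP => [[y _ ->]|->].
  by apply/eqP; rewrite eq_porbit_mem.
by exists x.
Qed.

Lemma cyclicp_conj (s : 'S_n) : reflect (exists r, s = (rotp ^ r)%g) (cyclicp s).
Proof.
apply: (iffP idP) => [/(cyclicpP s (pt 0)) Hs | [r ->]]; last first.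
  apply/(cyclicpP _ (r (pt 0))) => y; apply/porbitP; exists (r^-1%g y : 'I_n).
  have E t : ((rotp ^ r) ^+ t)%g (r (pt 0)) = r (pt t).
    elim: t => [|t IH]; first by rewrite expg0 perm1.
    by rewrite expgSr permM IH permJ rotp_pt.
  by rewrite E pt_val permKV.
have cardn : #|porbit s (pt 0)| = n.
  rewrite -[RHS]card_ord -cardsT; congr #|pred_of_set _|.
  by apply/setP => y; rewrite Hs inE.
(* The conjugator sends time [j] to the [j]-th iterate of [pt 0]; it is injective because the orbit
   has [n] points. *)
pose g (j : 'I_n) := iter j s (pt 0).
have g_inj : injective g.
  move=> j l E; apply/val_inj/eqP.
  have := uniq_traject_porbit s (pt 0); rewrite cardn => U.
  have nthE (i : 'I_n) : nth (pt 0) (traject s (pt 0) n) i = g i.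
    by rewrite nth_traject.
  have lts (i : 'I_n) : i < size (traject s (pt 0) n) by rewrite size_traject.
  by rewrite -(nth_uniq (pt 0) (lts j) (lts l) U) !nthE E.
exists (perm g_inj); apply/permP => y.
rewrite -[y](permKV (perm g_inj)) permJ.
move: ((perm g_inj)^-1%g y) => j; rewrite !permE /g /=.
have [lt|le] := ltnP j.+1 n; first by rewrite modn_small.
have -> : j.+1 = n by apply/eqP; rewrite eqn_leq le ltn_ord.
rewrite modnn /= -iterS; have -> : j.+1 = n by apply/eqP; rewrite eqn_leq le ltn_ord.
by have := iter_porbit s (pt 0); rewrite cardn => ->.
Qed.

(** The conjugators that produce a given cyclic permutation form a coset of the centralizer of the
    rotation. *)
Lemma card_aligned neg :
  #|[set r | aligned neg r]|
  = #|[set s : 'S_n | cyclicp s && compat f neg s]| * #|'C[rotp]%g|.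
Proof.
rewrite -sum1_card (partition_big (fun r => (rotp ^ r)%g)
  (mem [set s : 'S_n | cyclicp s && compat f neg s])) /=; last first.
  move=> r; rewrite !inE /aligned => ->; rewrite andbT; apply/cyclicp_conj; by exists r.
rewrite -sum_nat_const; apply: eq_bigr => s; rewrite inE => /andP[].
move=> /cyclicp_conj[r0 Es] cs; rewrite sum1_card -(card_rcoset _ r0).
apply: eq_card => r; rewrite mem_rcoset unfold_in /= inE /aligned.
apply/andP/cent1P => [[_ /eqP E]|].
  by apply/commute_sym/commgP/conjg_fixP; rewrite conjgM E Es conjgK.
move/commute_sym/commgP/conjg_fixP => E.
have E2 : (rotp ^ r)%g = s by rewrite Es -{2}E -conjgM mulgKV.
by rewrite E2.
Qed.

(** Choosing a flipped [r'] for each [r] is injective: [r'] has the itineraries of [r], hence the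
    same parities, and so determines the comparisons of [r]. *)
Lemma aligned_leq neg :
  #|[set r | aligned neg r]| <= #|[set r | aligned (fun a => ~~ neg a) r]|.
Proof.
have ex r : exists r', aligned neg r ->
    aligned (fun a => ~~ neg a) r' /\ flipped r r'.
  case: (boolP (aligned neg r)) => [/flip_exists[r' Ha Hf]|_]; last by exists r.
  by exists r'.
have [F HF] := fin_all_exists ex.
rewrite -(card_in_imset (f := F)) => [|r1 r2]; last first.
  rewrite !inE => /HF[_ [f1 o1]] /HF[_ [f2 o2]] E.
  apply: eq_perm_lt => j l ne; have := o1 _ _ ne; rewrite E o2 //.
  have -> : flip_parity (fun t => f (r2 (pt t))) n j l =
            flip_parity (fun t => f (r1 (pt t))) n j l.
    by apply: flip_parity_ext => t; rewrite -f1 -f2 E.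
  by move/addIb.
apply: subset_leq_card; apply/subsetP => _ /imsetP[r Hr ->].
by move: Hr; rewrite !inE => /HF[].
Qed.

Lemma card_compat_flip neg :
  #|[set s : 'S_n | cyclicp s && compat f neg s]|
  = #|[set s : 'S_n | cyclicp s && compat f (fun a => ~~ neg a) s]|.
Proof.
have C0 : 0 < #|'C[rotp]%g| by apply: cardG_gt0.
apply/eqP; rewrite -(eqn_pmul2r C0) -!card_aligned eqn_leq aligned_leq /=.
apply: leq_trans (aligned_leq _) _; apply: subset_leq_card.
apply/subsetP => r; rewrite !inE => /alignedP H; apply/alignedP => j l ne ef.
by rewrite H // negbK.
Qed.

End Rotation.

(** * Descents, segments and conjugation by the reversal *)

Definition desc m (s : 'S_m.+1) (i : nat) : bool := s (inord i.+1) < s (inord i).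

Definition seg n (e1 e2 : nat) (i : 'I_n) : nat := (e1 <= i) + (e2 <= i).

Section Descents.

Variable m : nat.
Let n := m.+1.

Lemma desc_neg (s : 'S_n) i : i.+1 < n ->
  (s (inord i) < s (inord i.+1)) = ~~ desc s i.
Proof.
move=> lti; rewrite /desc -leqNgt [RHS]leq_eqVlt.
case: eqP => [E|//]; have := congr1 val (perm_inj (val_inj E)).
by rewrite /= !inordK ?(ltnW lti) // => /n_Sn.
Qed.

(** The level sets of a nondecreasing [f] are intervals, so comparisons of neighbours chain by
    transitivity. *)
Lemma compat_adjacent (f : 'I_n -> nat) neg (s : 'S_n) :
  (forall i j : 'I_n, i <= j -> f i <= f j) ->
  reflect (forall i, i.+1 < n -> f (inord i) = f (inord i.+1) ->
             desc s i = neg (f (inord i)))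
          (compat f neg s).
Proof.
move=> f_homo; apply: (iffP idP) => [/compatP H i lti ef | H].
  apply: negb_inj; rewrite -desc_neg // H //.
    by rewrite !inordK ?(ltnW lti) // ltnSn.
  by rewrite -val_eqE /= !inordK ?(ltnW lti) // neq_ltn ltnSn.
have key d i : i + d.+1 < n -> f (inord i) = f (inord (i + d.+1)) ->
    (s (inord i) < s (inord (i + d.+1))) = ~~ neg (f (inord i)).
  elim: d => [|d IH] ltd.
    by rewrite addn1 => ef; rewrite desc_neg ?H // -addn1.
  have ltd' : i + d.+1 < n by apply: ltn_trans ltd; rewrite ltn_add2l.
  have lti : i < n by apply: leq_ltn_trans ltd'; apply: leq_addr.
  move=> ef; have em : f (inord i) = f (inord (i + d.+1)).
    apply/eqP; rewrite eqn_leq f_homo ?inordK ?leq_addr //= ef f_homo // !inordK //.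
    by rewrite leq_add2l.
  have := IH ltd' em; have := H (i + d.+1).
  rewrite -addnS -em ef => /(_ ltd erefl); rewrite /desc -addnS.
  move: (val (s (inord i))) (val (s (inord (i + d.+1)))) (val (s (inord (i + d.+2)))).
  by move=> x y z; case: (neg _) => /=; lia.
apply/forallP => i; apply/forallP => j; apply/implyP => /andP[lij /eqP ef].
have := key (j - i.+1) i; rewrite -addSnnS subnKC // !inord_val => -> //.
Qed.

Lemma seg_homo e1 e2 (i j : 'I_n) : i <= j -> seg e1 e2 i <= seg e1 e2 j.
Proof. by rewrite /seg => ?; lia. Qed.

Lemma compat_seg_ppm e1 e2 (s : 'S_n) : e1 <= e2 ->
  compat (seg e1 e2) (fun a => a == 2) s = fits n (desc s) e2 e1 e2.
Proof.
move=> e12; apply/(compat_adjacent _ _ (@seg_homo e1 e2))/fitsP => H i lti.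
  by move=> n1 n2; rewrite H // /seg !inordK ?(ltnW lti) //; lia.
rewrite /seg !inordK ?(ltnW lti) // => E.
by rewrite H //; clear -E e12; lia.
Qed.

Lemma compat_seg_pmm e1 e2 (s : 'S_n) : e1 <= e2 ->
  compat (seg e1 e2) (fun a => a != 0) s = fits n (desc s) e1 e1 e2.
Proof.
move=> e12; apply/(compat_adjacent _ _ (@seg_homo e1 e2))/fitsP => H i lti.
  by move=> n1 n2; rewrite H // /seg !inordK ?(ltnW lti) //; lia.
rewrite /seg !inordK ?(ltnW lti) // => E.
by rewrite H //; clear -E e12; lia.
Qed.

Definition revp : 'S_n := perm (@rev_ord_inj n).

Lemma cyclicpJ (s r : 'S_n) : cyclicp (s ^ r)%g = cyclicp s.
Proof.
apply/cyclicp_conj/cyclicp_conj => [] [t E].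
  by exists (t * r^-1)%g; rewrite conjgM -E conjgK.
by exists (t * r)%g; rewrite conjgM E.
Qed.

(** Positions and values are both reversed, so each segment keeps its sign while segment [a] becomes
    segment [2 - a]. *)
Lemma compat_revp e1 e2 neg (s : 'S_n) : e1 <= n -> e2 <= n ->
  compat (seg e1 e2) neg s
  = compat (seg (n - e2) (n - e1)) (fun a => neg (2 - a)) (s ^ revp)%g.
Proof.
move=> e1n e2n; have segE i : seg (n - e2) (n - e1) (revp i) = 2 - seg e1 e2 i.
  by rewrite /seg permE /=; have := ltn_ord i; lia.
have seg2 (i : 'I_n) : seg e1 e2 i <= 2 by rewrite /seg; lia.
have revlt (i j : 'I_n) : (revp i < revp j) = (j < i).
  by rewrite !permE /=; have := ltn_ord i; have := ltn_ord j; lia.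
have lt_neg (i j : 'I_n) : i != j -> (j < i) = ~~ (i < j).
  by rewrite -val_eqE /=; lia.
apply/compatP/compatP => H i j ne.
  rewrite -[i](permKV revp) -[j](permKV revp) !permJ !revlt !segE.
  set i' := (_ i); set j' := (_ j).
  have ne' : i' != j' by rewrite (inj_eq perm_inj).
  move=> E; have Es : seg e1 e2 i' = seg e1 e2 j'.
    move: (seg2 i') (seg2 j') E; move: (seg e1 e2 i') (seg e1 e2 j').
    by clear => x y; lia.
  rewrite subKn // (lt_neg (s i')) ?(inj_eq perm_inj) // (lt_neg i') // H //.
  by case: (_ < _); case: (neg _).
move=> E; have := H (revp i) (revp j); rewrite (inj_eq perm_inj) !segE E.
rewrite !permJ !revlt subKn // => /(_ ne erefl).
rewrite (lt_neg (s i) (s j)) ?(inj_eq perm_inj) // (lt_neg i j) //.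
by do 2 case: (_ < _); case: (neg _).
Qed.

(** The sign flip turns ++- into --+, and the reversal turns this into +-- with cuts [n - e2] and
    [n - e1]. *)
Lemma card_fits_flip e1 e2 : n %% 4 != 2 -> e1 <= e2 -> e2 <= n ->
  #|[set s : 'S_n | cyclicp s && fits n (desc s) e2 e1 e2]|
  = #|[set s : 'S_n | cyclicp s && fits n (desc s) (n - e2) (n - e2) (n - e1)]|.
Proof.
move=> n4 e12 e2n; have e1n := leq_trans e12 e2n.
transitivity #|[set s : 'S_n | cyclicp s && compat (seg e1 e2) (fun a => a == 2) s]|.
  by apply: eq_card => s; rewrite !inE compat_seg_ppm.
rewrite card_compat_flip //; last exact: seg_homo.
rewrite -[RHS](card_preimset _ (@conjg_inj _ revp)).
apply: eq_card => s; rewrite !inE cyclicpJ (compat_revp _ _ e1n e2n).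
rewrite -compat_seg_pmm ?leq_sub2l //; congr (_ && _).
by apply/compatP/compatP => H i j ne E; rewrite H //; lia.
Qed.

Lemma cyclicp_invol (s : 'S_n) : cyclicp s -> (s * s = 1)%g -> n <= 2.
Proof.
move=> /(cyclicpP s ord0) Hs ss1.
have <- : #|[set ord0; s ord0]| = n.
  rewrite -[RHS]card_ord -cardsT; congr #|pred_of_set _|; apply/setP => y.
  rewrite [RHS]inE; have /porbitP[i ->] := Hs y.
  elim: i => [|i]; first by rewrite expg0 perm1 !inE eqxx.
  rewrite expgSr permM !inE => /orP[] /eqP ->; first by rewrite eqxx orbT.
  by rewrite -permM ss1 perm1 eqxx.
by rewrite cards2; case: (_ != _).
Qed.

(** Such an [s] preserves all comparisons or reverses them all; either way its square preserves
    them. *)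
Lemma desc_const_invol b (s : 'S_n) :
  (forall i, i < m -> desc s i = b) -> (s * s = 1)%g.
Proof.
move=> H; have /compatP C : compat (fun _ => 0) (fun _ => b) s.
  by apply/compat_adjacent => // i lti _; apply: H.
apply: eq_perm_lt => j l ne; rewrite !permM !perm1 C ?(inj_eq perm_inj) // C //.
by case: b {C H}; rewrite /= ?addbF // !addbT negbK.
Qed.

(** * Class membership in terms of descents *)

Lemma mono_seg (s : 'S_n) (b : bool) a c : c <= n ->
  reflect (forall i, a <= i -> i.+1 < c -> desc s i = ~~ b)
    (if b then sorted ltn (drop a (take c (oneline s)))
     else sorted (fun x y => y < x) (drop a (take c (oneline s)))).
Proof.
move=> cn; have szo : size (oneline s) = n by rewrite size_map size_enum_ord.
have szd : size (drop a (take c (oneline s))) = c - a.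
  by rewrite size_drop size_take szo; case: ltnP; lia.
have nthE i : i < c -> nth 0 (take c (oneline s)) i = s (inord i).
  move=> ltic; have ltin := leq_trans ltic cn.
  rewrite nth_take // /oneline (nth_map ord0) ?size_enum_ord //.
  by congr (val (s _)); apply: val_inj; rewrite /= nth_enum_ord ?inordK.
have red (e : rel nat) : reflect (forall i, a <= i -> i.+1 < c ->
      e (s (inord i)) (s (inord i.+1))) (sorted e (drop a (take c (oneline s)))).
  apply: (iffP (sortedP 0)) => H i.
    move=> ai ic; have := H (i - a); rewrite szd !nth_drop.
    by rewrite addnS subnKC // !nthE ?(ltnW ic) //; apply; lia.
  by rewrite szd !nth_drop addnS => lti; rewrite !nthE ?H; lia.
case: b; apply: (iffP (red _)) => H i ai ic; have := H i ai ic.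
- by rewrite /= desc_neg ?(leq_trans ic) // => /negbTE.
- by rewrite /= desc_neg ?(leq_trans ic) // => ->.
- by [].
- by [].
Qed.

Lemma in_class3 b0 b1 b2 (w : seq nat) :
  let mono b x := if b then sorted ltn x else sorted (fun a b => b < a) x in
  in_class n [:: b0; b1; b2] w
  = [exists e1 : 'I_n.+1, exists e2 : 'I_n.+1,
      [&& e1 <= e2, mono b0 (drop 0 (take e1 w)),
          mono b1 (drop e1 (take e2 w)) & mono b2 (drop e2 (take n w))]].
Proof.
move=> mono; apply/existsP/existsP => [[e] | [e1 /existsP[e2]]].
  case/and4P => /eqP e0 /eqP e3 /forallP le /forallP sg.
  exists (e (inord 1)); apply/existsP; exists (e (inord 2)).
  have /forallP/(_ (inord 2))/implyP := le (inord 1).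
  rewrite !inordK // => -> //=.
  have E0 : e (inord 0) = 0 :> nat.
    by rewrite -[RHS]e0; congr (val (e _)); apply: val_inj; rewrite /= inordK.
  have E3 : e (inord 3) = n :> nat.
    by rewrite -[RHS]e3; congr (val (e _)); apply: val_inj; rewrite /= inordK.
  have /= := sg (@Ordinal 3 0 isT); have /= := sg (@Ordinal 3 1 isT).
  have /= := sg (@Ordinal 3 2 isT); rewrite E0 E3.
  by rewrite /mono => -> -> ->.
case/and4P => e12 m0 m1 m2.
(* The default [ord_max] of [nth] supplies the last cut [n]. *)
pose e : {ffun 'I_4 -> 'I_n.+1} :=
  [ffun i : 'I_4 => nth ord_max [:: ord0; e1; e2] i].
have eE k : k < 4 -> e (inord k) = nth ord_max [:: ord0; e1; e2] k.
  by move=> lt; rewrite ffunE inordK.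
exists e; apply/and4P; split.
- by rewrite ffunE.
- by rewrite ffunE.
- apply/forallP => i; apply/forallP => j; apply/implyP; rewrite !ffunE.
  by case: i => -[|[|[|[|i]]]] Hi //; case: j => -[|[|[|[|j]]]] Hj //= _;
    rewrite -ltnS.
- by apply/forallP => -[[|[|[|i]]] Hi] //=; rewrite !eE.
Qed.

Lemma in_class_ppm (s : 'S_n) :
  in_class n [:: true; true; false] (oneline s)
  = [exists e1 : 'I_n.+1, exists e2 : 'I_n.+1,
      (e1 <= e2) && fits n (desc s) e2 e1 e2].
Proof.
rewrite in_class3; apply: eq_existsb => e1; apply: eq_existsb => e2.
have e1n : e1 <= n by rewrite -ltnS.
have e2n : e2 <= n by rewrite -ltnS.
case: (leqP e1 e2) => //= e12.
apply/and3P/fitsP => [[/(mono_seg s true _ e1n) H0 /(mono_seg s true _ e2n) H1] |H].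
  move=> /(mono_seg s false _ (leqnn n)) H2 i lti n1 n2.
  have [le|lt] := leqP e2 i; first exact: H2.
  have [le|lt1] := leqP e1 i; first by apply: H1; lia.
  by apply: H0; lia.
split; [apply/(mono_seg s true _ e1n)|apply/(mono_seg s true _ e2n)
       |apply/(mono_seg s false _ (leqnn n))] => i ai ic; rewrite H /=; lia.
Qed.

Lemma in_class_pmm (s : 'S_n) :
  in_class n [:: true; false; false] (oneline s)
  = [exists e1 : 'I_n.+1, exists e2 : 'I_n.+1,
      (e1 <= e2) && fits n (desc s) e1 e1 e2].
Proof.
rewrite in_class3; apply: eq_existsb => e1; apply: eq_existsb => e2.
have e1n : e1 <= n by rewrite -ltnS.
have e2n : e2 <= n by rewrite -ltnS.
case: (leqP e1 e2) => //= e12.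
apply/and3P/fitsP => [[/(mono_seg s true _ e1n) H0 /(mono_seg s false _ e2n) H1] |H].
  move=> /(mono_seg s false _ (leqnn n)) H2 i lti n1 n2.
  have [le|lt] := leqP e1 i; last by apply: H0; lia.
  have [le2|lt2] := leqP e2 i; first exact: H2.
  by apply: H1; lia.
split; [apply/(mono_seg s true _ e1n)|apply/(mono_seg s false _ e2n)
       |apply/(mono_seg s false _ (leqnn n))] => i ai ic; rewrite H /=; lia.
Qed.

End Descents.

(** * Double counting over the cyclic permutations *)

Lemma sum_cyclicp_bool n (P : pred 'S_n) :
  \sum_(s : 'S_n | cyclicp s) P s = #|[set s : 'S_n | cyclicp s && P s]|.
Proof.
rewrite -sum1_card big_mkcond [RHS]big_mkcond; apply: eq_bigr => s _.
by rewrite inE; case: (cyclicp s); case: (P s).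
Qed.

Theorem theorem5p2 (n : nat) : 1 <= n -> n %% 4 != 2 -> c5 n = c6 n.
Proof.
case: n => // m _ n4; set n := m.+1.
pose A e1 e2 := #|[set s : 'S_n | cyclicp s && fits n (desc s) e2 e1 e2]|.
pose B e1 e2 := #|[set s : 'S_n | cyclicp s && fits n (desc s) e1 e1 e2]|.
have ordle (e : 'I_n.+1) : e <= n by rewrite -ltnS.
have AB (e1 e2 : 'I_n.+1) : e1 <= e2 -> A e1 e2 = B (rev_ord e2) (rev_ord e1).
  by move=> e12; rewrite /A card_fits_flip.
have sumAB : \sum_(e1 < n.+1) \sum_(e2 < n.+1) (e1 <= e2) * A e1 e2
           = \sum_(e1 < n.+1) \sum_(e2 < n.+1) (e1 <= e2) * B e1 e2.
  rewrite exchange_big (reindex_inj rev_ord_inj); apply: eq_bigr => e1 _.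
  rewrite (reindex_inj rev_ord_inj); apply: eq_bigr => e2 _.
  have -> : (rev_ord e2 <= rev_ord e1) = (e1 <= e2).
    by rewrite /= !subSS; have := ordle e1; have := ordle e2; lia.
  case: (leqP e1 e2) => // e12; rewrite !mul1n AB ?rev_ordK //=.
  by rewrite !subSS leq_sub2l.
(* With equal cuts both signatures reduce to +-, so [A] and [B] coincide on the diagonal and [AB]
   makes [A e e] symmetric under [e] to [n - e]. *)
have sumd : \sum_(e < n.+1) e * A e e = \sum_(e < n.+1) (n - e) * A e e.
  rewrite [RHS](reindex_inj rev_ord_inj); apply: eq_bigr => e _.
  by rewrite /= AB //= subSS subKn // ordle.
have U0 : \sum_(s : 'S_n | cyclicp s) ([exists e : 'I_n.+1, fits n (desc s) e e e]
              && ~~ [forall i : 'I_m, ~~ desc s i])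
        = \sum_(s : 'S_n | cyclicp s) ([exists e : 'I_n.+1, fits n (desc s) e e e]
              && ~~ [forall i : 'I_m, desc s i]).
  apply: eq_bigr => s cs; congr (nat_of_bool (_ && ~~ _)).
  (* An index [i] forces [n >= 2], a cyclic involution [n <= 2], and [n4] excludes 2. Without an
     index, for [m = 0], both conditions hold vacuously. *)
  have no_step (i : 'I_m) : (s * s)%g <> 1%g.
    move=> ss1; have := cyclicp_invol cs ss1; have := leq_ltn_trans (leq0n i) (ltn_ord i).
    by move: n4; clear; lia.
  apply/forallP/forallP => H i; case: (no_step i).
    apply: (@desc_const_invol m false) => k ltk.
    by apply/negbTE; apply: (H (Ordinal ltk)).
  by apply: (@desc_const_invol m true) => k ltk; apply: (H (Ordinal ltk)).
have sum2 (F : 'S_n -> nat -> nat -> bool) :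
    \sum_(s : 'S_n | cyclicp s) \sum_(e1 < n.+1) \sum_(e2 < n.+1)
       ((e1 <= e2) && F s e1 e2 : nat)
    = \sum_(e1 < n.+1) \sum_(e2 < n.+1)
       (e1 <= e2) * #|[set s : 'S_n | cyclicp s && F s e1 e2]|.
  rewrite exchange_big; apply: eq_bigr => e1 _.
  rewrite exchange_big; apply: eq_bigr => e2 _.
  rewrite -sum_cyclicp_bool big_distrr; apply: eq_bigr => s _ /=.
  by rewrite mulnb.
have sum1 (g : nat -> nat) :
    \sum_(s : 'S_n | cyclicp s) \sum_(e < n.+1) g e * fits n (desc s) e e e
    = \sum_(e < n.+1) g e * A e e.
  rewrite exchange_big; apply: eq_bigr => e _.
  by rewrite /A -sum_cyclicp_bool big_distrr.
have E5 : \sum_(e1 < n.+1) \sum_(e2 < n.+1) (e1 <= e2) * A e1 e2 =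
    2 * c5 n + \sum_(e < n.+1) e * A e e +
    \sum_(s : 'S_n | cyclicp s) ([exists e : 'I_n.+1, fits n (desc s) e e e]
              && ~~ [forall i : 'I_m, ~~ desc s i]).
  rewrite -(sum2 (fun s e1 e2 => fits n (desc s) e2 e1 e2)).
  under eq_bigr => s _ do rewrite count_ppm.
  rewrite big_split big_split /= (sum1 (fun e => e)) -big_distrr /=; congr (2 * _ + _ + _).
  rewrite /c5 /cnt /Cclass -sum_cyclicp_bool.
  by apply: eq_bigr => s _; rewrite in_class_ppm.
have E6 : \sum_(e1 < n.+1) \sum_(e2 < n.+1) (e1 <= e2) * B e1 e2 =
    2 * c6 n + \sum_(e < n.+1) (n - e) * A e e +
    \sum_(s : 'S_n | cyclicp s) ([exists e : 'I_n.+1, fits n (desc s) e e e]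
              && ~~ [forall i : 'I_m, desc s i]).
  rewrite -(sum2 (fun s e1 e2 => fits n (desc s) e1 e1 e2)).
  under eq_bigr => s _ do rewrite count_pmm.
  rewrite big_split big_split /= (sum1 (fun e => n - e)) -big_distrr /=; congr (2 * _ + _ + _).
  rewrite /c6 /cnt /Cclass -sum_cyclicp_bool.
  by apply: eq_bigr => s _; rewrite in_class_pmm.
by move: sumAB; rewrite E5 E6 -sumd -U0; lia.
Qed.
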